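(* For each positive integer $n$ write $H_n=1+\frac12+\cdots+\frac1n=c_n/d_n$ in lowest terms, let $D_n=\mathrm{lcm}(1,2,\ldots,n)$, and let $q_n=D_n/d_n$. Let $2<p_1<p_2<\cdots<p_k$ be prime numbers. Then there exists a positive integer $n$ such that $p_1p_2\cdots p_k\mid q_n$.
   Context: $H_n=c_n/d_n$ with $\gcd(c_n,d_n)=1$; $D_n=\mathrm{lcm}(1,\ldots,n)$; $q_n=D_n/d_n$. *)

(* Defs.v *)
From mathcomp Require Import all_boot all_order all_algebra.

Set Implicit Arguments.
Unset Strict Implicit.
Unset Printing Implicit Defensive.

Import GRing.Theory Num.Theory.

Local Open Scope ring_scope.

Definition harmonic (n : nat) : rat := \sum_(1 <= i < n.+1) i%:R^-1.

(* [denq] is the positive denominator of the reduced fraction. *)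
Definition harmonic_den (n : nat) : nat := `|denq (harmonic n)|%N.

Definition lcm_upto (n : nat) : nat := \big[lcmn/1%N]_(1 <= i < n.+1) i.

(* The quotient is exact, see [harmonic_den_dvd]. *)
Definition harmonic_quot (n : nat) : nat := (lcm_upto n %/ harmonic_den n)%N.

Lemma harmonic_den_dvd (n : nat) : (harmonic_den n %| lcm_upto n)%N.
Proof.
have [m Hm] : exists m : int, harmonic n * (lcm_upto n)%:R = m%:~R.
  apply/intrP; rewrite /harmonic mulr_suml.
  rewrite big_nat_cond; apply: rpred_sum => i; rewrite andbT => /andP[i_gt0 le_in].
  have /dvdnP[k ->] : (i %| lcm_upto n)%N.
    rewrite /lcm_upto (big_rem i) ?mem_index_iota ?i_gt0 //=.
    exact: dvdn_lcml.
  have i_neq0 : i%:R != 0 :> rat by rewrite pnatr_eq0 -lt0n.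
  by rewrite natrM mulrC mulfK // rpred_nat.
have E : numq (harmonic n) * (lcm_upto n)%:Z = m * denq (harmonic n).
  apply/eqP; rewrite -(eqr_int rat) !rmorphM /= -Hm numqE.
  by rewrite mulrAC.
have : (denq (harmonic n) %| numq (harmonic n) * (lcm_upto n)%:Z)%Z.
  by rewrite E dvdz_mull.
rewrite Gauss_dvdzr; first by rewrite dvdzE absz_nat.
by rewrite coprimezE coprime_sym coprime_num_den.
Qed.

(* Main.v *)
(** An odd prime [p] divides [q_n] as soon as [n >= p] and the leading digit
    of [n] in base [p] is [p - 1]: with [p^k <= n < p^(k+1)], only the terms
    [D_n / i] with [p^k] dividing [i] matter modulo [p], and these cancel in
    pairs under [i <-> p^(k+1) - i].

    For any [Q], some [n] has leading digit [p - 1] in all bases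
    [2 <= p < Q] at once: by the pigeonhole principle (a multiplicative form of
    Dirichlet's simultaneous approximation), some number [y] is, for each [p],
    within a factor [1 + 1/M] of a power of [p]; then take [n] slightly below
    [y]. *)
Require Import Defs.
From mathcomp Require Import all_boot all_order all_algebra.
From mathcomp Require Import zify.

Set Implicit Arguments.
Unset Strict Implicit.
Unset Printing Implicit Defensive.

Import GRing.Theory Num.Theory.

Lemma lcm_upto_dvd n i : 0 < i <= n -> i %| lcm_upto n.
Proof.
move=> lein; rewrite /lcm_upto (big_rem i) ?mem_index_iota //=.
exact: dvdn_lcml.
Qed.

Section RatSums.
Local Open Scope ring_scope.

Lemma harmonic_mul_lcm n :
  harmonic n * (lcm_upto n)%:R = (\sum_(1 <= i < n.+1) lcm_upto n %/ i)%:R.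
Proof.
rewrite natr_sum mulr_suml; apply: eq_big_nat => i lein.
have /dvdnP[m ->] := lcm_upto_dvd lein.
have i0 : (0 < i)%N by case/andP: lein.
by rewrite mulnK // natrM mulrC mulfK // pnatr_eq0 -lt0n.
Qed.

Lemma harmonic_den_dvd_nat n d m :
  harmonic n * d%:R = m%:R -> (harmonic_den n %| d)%N.
Proof.
move=> Hm.
have E : numq (harmonic n) * d%:Z = m%:Z * denq (harmonic n).
  by apply/eqP; rewrite -(eqr_int rat) !rmorphM /= -!pmulrn numqE mulrAC Hm.
have : (denq (harmonic n) %| numq (harmonic n) * d%:Z)%Z.
  by rewrite E dvdz_mull.
rewrite Gauss_dvdzr; first by rewrite dvdzE absz_nat.
by rewrite coprimezE coprime_sym coprime_num_den.
Qed.

(** Cancelling [p] from [D_n = d * p] and from the sum [s * p] gives [H_n * d = s], so the reduced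
    denominator already divides [d] and the factor [p] survives in the quotient. *)
Lemma dvdn_harmonic_quot n p : (0 < p)%N -> (p %| lcm_upto n)%N ->
  (p %| \sum_(1 <= i < n.+1) lcm_upto n %/ i)%N -> (p %| harmonic_quot n)%N.
Proof.
move=> p0 /dvdnP[d Dd] /dvdnP[s Ds].
have dd : (harmonic_den n %| d)%N.
  apply: (@harmonic_den_dvd_nat n d s).
  apply: (@mulIf _ p%:R); first by rewrite pnatr_eq0 -lt0n.
  by rewrite -mulrA -!natrM -Dd harmonic_mul_lcm Ds.
by rewrite /harmonic_quot Dd -divn_mulAC // dvdn_mull.
Qed.

End RatSums.

(** Here [i = u * p ^ v] with [v < k], so [p * i] is a product of the coprime numbers [u] and
    [p ^ v.+1], both at most [n]; hence [p * i] divides [D_n]. *)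
Lemma dvdn_lcm_upto_div n p k i : prime p -> p ^ k <= n -> 0 < i <= n ->
  ~~ (p ^ k %| i) -> p %| lcm_upto n %/ i.
Proof.
move=> pp len lein ndvd; have /andP[i0 le_in] := lein.
rewrite dvdn_divRL; last exact: lcm_upto_dvd.
have [u cpu Di] := pfactor_coprime pp i0.
set v := logn p i in Di.
have ltvk : v < k by rewrite ltnNge -pfactor_dvdn.
have u0 : 0 < u by case: u Di {cpu} => // Di; rewrite Di in i0.
have -> : p * i = u * p ^ v.+1 by rewrite {1}Di expnS mulnCA.
rewrite Gauss_dvd; last by rewrite coprimeXr // coprime_sym.
apply/andP; split; apply: lcm_upto_dvd.
  by rewrite u0 (leq_trans _ le_in) // Di leq_pmulr // expn_gt0 prime_gt0.
rewrite expn_gt0 prime_gt0 //= (leq_trans _ len) // leq_exp2l //.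
exact: prime_gt1.
Qed.

(** For [i = j * p ^ k] the two quotients [a], [b] satisfy [a * j = b * (p - j)], so
    [(a + b) * j = b * p], while [p] does not divide [j]. *)
Lemma dvdn_lcm_upto_pair n p k i : prime p -> p.-1 * p ^ k <= n ->
  0 < i < p ^ k.+1 -> p ^ k %| i ->
  p %| lcm_upto n %/ i + lcm_upto n %/ (p ^ k.+1 - i).
Proof.
move=> pp len /andP[i0 ltip] /dvdnP[j Dj].
have pk0 : 0 < p ^ k by rewrite expn_gt0 prime_gt0.
have p1 := prime_gt1 pp.
have j0 : 0 < j by case: j Dj i0 => // ->.
have ltjp : j < p by move: ltip; rewrite Dj expnS ltn_pmul2r.
have dvdD l : 0 < l < p -> l * p ^ k %| lcm_upto n.
  move=> /andP[l0 lp]; apply: lcm_upto_dvd; rewrite muln_gt0 l0 pk0 /=.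
  by rewrite (leq_trans _ len) // leq_mul2r; apply/orP; right; lia.
have /dvdnP[a Da] := dvdD j (introT andP (conj j0 ltjp)).
have rj : 0 < p - j < p by lia.
have /dvdnP[b Db] := dvdD _ rj.
have -> : p ^ k.+1 - i = (p - j) * p ^ k by rewrite Dj expnS mulnBl.
rewrite {1}Da Db Dj !mulnK ?muln_gt0 ?j0 //; last by case/andP: rj => ->.
have /eqP eab : a * j == b * (p - j).
  by rewrite -(eqn_pmul2r pk0) -!mulnA -Da Db.
have : p %| (a + b) * j.
  have -> : (a + b) * j = b * p by rewrite mulnDl eab -mulnDr subnK // ltnW.
  exact: dvdn_mull.
by rewrite Gauss_dvdl // prime_coprime // gtnNdvd.
Qed.

Lemma dvdn_sum_lcm_upto n p k : prime p -> 2 < p ->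
  p.-1 * p ^ k <= n < p ^ k.+1 ->
  p %| \sum_(1 <= i < n.+1) lcm_upto n %/ i.
Proof.
move=> pp p2 /andP[len ltn].
have pk0 : 0 < p ^ k by rewrite expn_gt0 prime_gt0.
have lepk : p ^ k <= n by rewrite (leq_trans _ len) // leq_pmull //; lia.
rewrite (bigID (fun i => p ^ k %| i)) /= dvdn_addl; last first.
  rewrite big_nat_cond; apply: dvdn_sum => i /andP[lein ndvd].
  exact: dvdn_lcm_upto_div ndvd.
(* No multiple of [p ^ k] lies strictly between [n] and [p ^ k.+1]; the extended range is symmetric
   under reflection. *)
have -> : \sum_(1 <= i < n.+1 | p ^ k %| i) lcm_upto n %/ i =
          \sum_(1 <= i < p ^ k.+1 | p ^ k %| i) lcm_upto n %/ i.
  rewrite [RHS](@big_cat_nat _ _ _ n.+1) //= [X in _ = _ + X]big_nat_cond.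
  rewrite [X in _ = _ + X]big_pred0 ?addn0 // => i.
  apply/negP => /andP[/andP[ltni ltip] /dvdnP[j Dj]].
  move: ltip; rewrite Dj expnS ltn_pmul2r // => ltjp.
  have : j * p ^ k <= p.-1 * p ^ k by rewrite leq_mul2r; apply/orP; right; lia.
  by rewrite -Dj; lia.
set S := \sum_(_ <= _ < _ | _) _.
have SS : S + S = \sum_(1 <= i < p ^ k.+1 | p ^ k %| i)
    (lcm_upto n %/ i + lcm_upto n %/ (p ^ k.+1 - i)).
  rewrite big_split /=; congr addn; rewrite /S big_nat_rev /=.
  rewrite big_nat_cond [RHS]big_nat_cond; apply: eq_big => i.
    apply: andb_id2l => /andP[i0 ltip].
    by rewrite add1n subSS dvdn_subr ?dvdn_exp2l // ltnW.
  by rewrite add1n subSS.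
(* Reflection counts each pair twice; the factor 2 is cancelled because [p] is odd. *)
have: p %| 2 * S.
  rewrite mul2n -addnn SS big_nat_cond; apply: dvdn_sum => i /andP[li dvdi].
  exact: dvdn_lcm_upto_pair.
by rewrite Gauss_dvdr // prime_coprime // gtnNdvd.
Qed.

Lemma prime_dvd_harmonic_quot n p k : prime p -> 2 < p -> p <= n ->
  p.-1 * p ^ k <= n < p ^ k.+1 -> p %| harmonic_quot n.
Proof.
move=> pp p2 lepn lead; apply: dvdn_harmonic_quot; first exact: prime_gt0.
  by apply: lcm_upto_dvd; rewrite prime_gt0.
exact: dvdn_sum_lcm_upto lead.
Qed.

Lemma leq_mulS_mono M c y R : M <= c -> c * y < c.+1 * R -> M * y <= M.+1 * R.
Proof.
move=> leMc ltyR; have [|leyR] := leqP y R; first by nia.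
have := leq_mul leMc (leqnn (y - R)); rewrite !mulnBr; nia.
Qed.

Lemma near_powers Q M : 0 < M -> exists2 e, 0 < e &
  forall p, 1 < p < Q -> exists m,
    M * M.+1 ^ e <= M.+1 * p ^ m /\ M * p ^ m <= M.+1 * M.+1 ^ e.
Proof.
move=> M0.
pose x t := M.+1 ^ t.
pose E p t := trunc_log p (x t).
pose b t p := (M * x t) %/ p ^ E p t.
have x0 t : 0 < x t by rewrite expn_gt0.
have bP t p : 1 < p -> [/\ M <= b t p < M * p, b t p * p ^ E p t <= M * x t &
    M * x t < (b t p).+1 * p ^ E p t].
  move=> p1; have /andP[lo hi] := trunc_log_bounds p1 (x0 t).
  have P0 : 0 < p ^ E p t by rewrite expn_gt0 ltnW.
  rewrite /b; split; last 2 first.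
  - exact: leq_divM.
  - exact: ltn_ceil.
  rewrite leq_divRL // leq_mul2l lo orbT /= ltn_divLR // -mulnA -expnS.
  by rewrite ltn_pmul2l.
(* If [b s p = b t p >= M], then [x s / p ^ E p s] and [x t / p ^ E p t] agree
   up to a factor [1 + 1/M], so [x (t - s)] is that close to a power of [p]. *)
pose L := M * Q.
pose f (t : 'I_(#|{ffun 'I_Q -> 'I_L.+1}|.+1)) : {ffun 'I_Q -> 'I_L.+1} :=
  [ffun p => inord (b t (val p))].
have [s [t [ltst fst]]] : exists s t : 'I__, s < t /\ f s = f t.
  have /injectivePn[s [t nst fst]] : ~~ injectiveb f.
    by apply/injectiveP => /leq_card; rewrite card_ord ltnn.
  case: (ltngtP s t) => [lt|lt|/val_inj e]; first by exists s, t.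
    by exists t, s.
  by rewrite e eqxx in nst.
exists (t - s); first by rewrite subn_gt0.
move=> p /andP[p1 pQ].
have [/andP[bs1 bs2] bs3 bs4] := bP s p p1.
have [/andP[bt1 bt2] bt3 bt4] := bP t p p1.
have beq : b s p = b t p.
  have := congr1 (fun g : {ffun 'I_Q -> 'I_L.+1} => g (Ordinal pQ) : nat) fst.
  have leL c : c < M * p -> c < L.+1.
    by move=> ltc; rewrite ltnS (leq_trans (ltnW ltc)) // leq_mul2l ltnW ?orbT.
  by rewrite /= !ffunE !inordK // leL.
have leE : E p s <= E p t by apply: leq_trunc_log; rewrite leq_exp2l // ltnW.
exists (E p t - E p s).
have xE : x t = x s * M.+1 ^ (t - s) by rewrite -expnD subnKC // ltnW.
have PE : p ^ E p t = p ^ E p s * p ^ (E p t - E p s).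
  by rewrite -expnD subnKC.
have P0 : 0 < p ^ E p s by rewrite expn_gt0 ltnW.
move: bs1 bs3 bs4 bt3 bt4; rewrite beq xE PE.
set R := p ^ (_ - _); have v0 : 0 < M.+1 ^ (t - s) := x0 _.
move: (b t p) (x s) (p ^ E p s) P0 (M.+1 ^ _) v0.
move=> c u P P0 v v0 leMc lo1 hi1 lo2 hi2.
(* Chaining the bounds on [M * u] and [M * (u * v)] gives [c * v < c.+1 * R] and [c * R < c.+1 * v];
   since [M <= c], [c] may be replaced by [M]. *)
split; apply: (leq_mulS_mono leMc).
  rewrite -(ltn_pmul2r P0) mulnAC (leq_ltn_trans (leq_mul lo1 (leqnn v))) //.
  by rewrite -!mulnA [R * P]mulnC.
rewrite -(ltn_pmul2r P0) -mulnA [R * P]mulnC (leq_ltn_trans lo2) //.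
by rewrite mulnA [X in _ < X]mulnAC ltn_pmul2r.
Qed.

Lemma leading_digits_pred Q : exists2 n, Q <= n &
  forall p, 1 < p < Q -> exists k, p.-1 * p ^ k <= n < p ^ k.+1.
Proof.
(* This gives [3 * p <= M], enough for [(1 - 1/p) * (1 + 1/M)^2] to stay below 1 with room for the
   predecessor in [n]. *)
pose M := 3 * Q.+1.
have [|[//|e] _ near] := @near_powers Q M; first by [].
pose z := M.+1 ^ e.
have z0 : 0 < z by rewrite expn_gt0.
exists (M * z).-1.
  by have : M <= M * z by [rewrite leq_pmulr]; rewrite /M; lia.
move=> p /andP[p1 pQ]; have [m []] := near p (introT andP (conj p1 pQ)).
(* As [y = M.+1 * z], the lower estimate becomes exactly [M * z <= p ^ m], whence [n < p ^ m]. *)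
rewrite expnS -/z mulnCA leq_pmul2l // => lo hi.
case: m lo hi => [|k] lo hi.
  by exfalso; move: lo; rewrite expn0 /M; nia.
exists k; apply/andP; split; last by move: lo; rewrite /M; nia.
rewrite -(@leq_pmul2l (p * M)); last by rewrite muln_gt0 /M; lia.
have -> : p * M * (p.-1 * p ^ k) = p.-1 * (M * p ^ k.+1).
  by rewrite expnS; nia.
apply: leq_trans (leq_mul (leqnn _) hi) _.
have pM : p * 3 <= M by rewrite /M; lia.
case: p p1 pM {pQ lo hi} => // p p1 pM /=.
have : p.+1 * 3 * (M * z) <= M * (M * z) by rewrite leq_mul2r pM orbT.
have : p.+1 * 3 * z <= M * z by rewrite leq_mul2r pM orbT.
nia.
Qed.

Theorem theorem4 (ps : seq nat) (ps_incr : path ltn 2 ps)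
    (ps_prime : forall p, p \in ps -> prime p) :
  exists n : nat, 0 < n /\ \prod_(p <- ps) p %| harmonic_quot n.
Proof.
(* This bound exceeds every listed prime, so it also yields [p <= n]. *)
have [n leQn lead] := leading_digits_pred (\max_(p <- ps) p).+1.
exists n; split; first exact: leq_trans leQn.
have gt2 : all (ltn 2) ps by apply: order_path_min ps_incr => ???; apply: ltn_trans.
have dvdq p : p \in ps -> p %| harmonic_quot n.
  move=> pps; have p2 : 2 < p := allP gt2 p pps.
  have pQ : p <= \max_(p <- ps) p by exact: (@leq_bigmax_seq _ _ _ id).
  have [|k] := lead p; first by rewrite ltnS pQ ltnW.
  apply: prime_dvd_harmonic_quot => //; first exact: ps_prime.
  exact: leq_trans (leq_trans pQ (leqnSn _)) leQn.
have : uniq ps.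
  by apply: (sorted_uniq ltn_trans ltnn); apply: path_sorted ps_incr.
(* Distinct primes are coprime, so the separate divisibilities multiply. *)
elim: ps ps_prime dvdq {ps_incr leQn lead gt2} => [|p ps IH] pr dv /=.
  by rewrite big_nil.
case/andP => pnps ups; rewrite big_cons Gauss_dvd.
  rewrite dv ?mem_head //= IH // => q qps.
    by apply: pr; rewrite inE qps orbT.
  by apply: dv; rewrite inE qps orbT.
rewrite big_seq; apply: (big_ind (coprime p)) => [|a b pa pb|q qps].
- exact: coprimen1.
- by rewrite coprimeMr pa.
rewrite prime_coprime ?pr ?mem_head // dvdn_prime2 ?pr ?mem_head //.
  by apply: contraNneq pnps => ->.
by rewrite inE qps orbT.
Qed.
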